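(* For every $0<\alpha\le 1$ the space $g^\alpha_\alpha(\mathbb R^d_+)$ is trivial, i.e. $g^\alpha_\alpha(\mathbb R^d_+)=\{0\}$.
   Context: $\mathbb R^d_+=(0,\infty)^d$. Multi-index notation: for $k,p\in\mathbb N_0^d$, $|k|=k_1+\dots+k_d$, $x^{(p+k)/2}=\prod_j x_j^{(p_j+k_j)/2}$, $k^{(\alpha/2)k}=\prod_j k_j^{(\alpha/2)k_j}$ with $0^0=1$, $\partial^p=\partial_{x_1}^{p_1}\cdots\partial_{x_d}^{p_d}$. $\mathcal S(\mathbb R^d_+)$ is the space of $f\in C^\infty(\mathbb R^d_+)$ all of whose derivatives extend continuously to $[0,\infty)^d$ and satisfy $\sup_{x\in\mathbb R^d_+}x^\beta|\partial^\gamma f(x)|<\infty$ for all $\beta,\gamma\in\mathbb N_0^d$. For $\alpha>0$, $A>0$, $g^{\alpha,A}_{\alpha,A}(\mathbb R^d_+)$ is the space of all $f\in\mathcal S(\mathbb R^d_+)$ with $\sup_{p,k\in\mathbb N_0^d}\frac{\|x^{(p+k)/2}\partial^p f(x)\|_{L^2(\mathbb R^d_+)}}{A^{|p+k|}k^{(\alpha/2)k}p^{(\alpha/2)p}}<\infty$, and $g^\alpha_\alpha(\mathbb R^d_+)=\bigcap_{A>0}g^{\alpha,A}_{\alpha,A}(\mathbb R^d_+)$. *)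

(* Defs.v *)
From HB Require Import structures.
From mathcomp Require Import all_boot all_order all_algebra.
From mathcomp Require Import all_classical all_reals all_analysis.
Set Implicit Arguments. Unset Strict Implicit. Unset Printing Implicit Defensive.
Import Order.TTheory GRing.Theory Num.Theory.
Import numFieldNormedType.Exports.
Local Open Scope classical_set_scope.
Local Open Scope ring_scope.

Section GS.
Variables (R : realType) (d : nat).

Definition coord (x : 'rV[R]_d) (j : 'I_d) : R := x ord0 j.

Definition orthant : set 'rV[R]_d := [set x | forall j, 0 < coord x j].
Definition corthant : set 'rV[R]_d := [set x | forall j, 0 <= coord x j].

Definition unitv (j : 'I_d) : 'rV[R]_d := delta_mx ord0 j.
Definition pderiv (j : 'I_d) (f : 'rV[R]_d -> R) : 'rV[R]_d -> R :=
  fun x => 'D_(unitv j) f x.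

Definition pderivs (s : seq 'I_d) (f : 'rV[R]_d -> R) : 'rV[R]_d -> R :=
  foldr pderiv f s.

Definition mabs (p : 'I_d -> nat) : nat := (\sum_(j < d) p j)%N.
Definition mdirs (p : 'I_d -> nat) : seq 'I_d :=
  flatten [seq nseq (p j) j | j <- enum 'I_d].
Definition dmulti (p : 'I_d -> nat) (f : 'rV[R]_d -> R) := pderivs (mdirs p) f.

Definition xpow (x : 'rV[R]_d) (b : 'I_d -> nat) : R :=
  \prod_(j < d) coord x j ^+ b j.
Definition xhalf (x : 'rV[R]_d) (p k : 'I_d -> nat) : R :=
  \prod_(j < d) powR (coord x j) (((p j + k j)%:R) / 2).
(* prod_j k_j^{(alpha/2) k_j}, with 0^0 = 1 (powR 0 0 = 1) *)
Definition kpow (alpha : R) (k : 'I_d -> nat) : R :=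
  \prod_(j < d) powR (k j)%:R ((alpha / 2) * (k j)%:R).

(* Complex-valued functions f = u + i v are represented by the pair (u, v)
   of their real and imaginary parts; |f| = sqrt(u^2 + v^2). *)

Definition smooth_orthant (u : 'rV[R]_d -> R) : Prop :=
  forall s : seq 'I_d,
    (forall x, orthant x -> {for x, continuous (pderivs s u)}) /\
    (forall j x, orthant x -> derivable (pderivs s u) x (unitv j)).

Definition schwartz_orthant (u v : 'rV[R]_d -> R) : Prop :=
  smooth_orthant u /\ smooth_orthant v /\
  (forall p : 'I_d -> nat,
     (exists gu : 'rV[R]_d -> R, {within corthant, continuous gu} /\
        forall x, orthant x -> gu x = dmulti p u x) /\
     (exists gv : 'rV[R]_d -> R, {within corthant, continuous gv} /\
        forall x, orthant x -> gv x = dmulti p v x)) /\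
  (forall b g : 'I_d -> nat, exists C : R, forall x, orthant x ->
     xpow x b * Num.sqrt (dmulti g u x ^+ 2 + dmulti g v x ^+ 2) <= C).

(* integral over the open orthant (0,oo)^d w.r.t. Lebesgue measure, written as
   an iterated integral (for nonnegative measurable integrands this is the
   d-dimensional Lebesgue integral, by Tonelli) *)
Definition setcoord (x : 'rV[R]_d) (j : 'I_d) (t : R) : 'rV[R]_d :=
  \row_i (if i == j then t else x ord0 i).
Fixpoint iint (s : seq 'I_d) (h : 'rV[R]_d -> \bar R) (x : 'rV[R]_d)
  : \bar R :=
  match s with
  | [::] => h x
  | j :: s' => (\int[lebesgue_measure]_(t in [set t : R | (0 < t)%R])
                   iint s' h (setcoord x j t))%E
  end.
Definition int_orthant (h : 'rV[R]_d -> \bar R) : \bar R :=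
  iint (enum 'I_d) h 0.

Definition wL2norm (u v : 'rV[R]_d -> R) (p k : 'I_d -> nat) : \bar R :=
  sqrte (int_orthant (fun x =>
     ((xhalf x p k ^+ 2) * (dmulti p u x ^+ 2 + dmulti p v x ^+ 2))%:E)).

Definition gGS (alpha A : R) (u v : 'rV[R]_d -> R) : Prop :=
  schwartz_orthant u v /\
  exists C : R, forall p k : 'I_d -> nat,
    (wL2norm u v p k <=
      (C * (A ^+ (mabs p + mabs k) * kpow alpha k * kpow alpha p))%:E)%E.

Definition gGS_all (alpha : R) (u v : 'rV[R]_d -> R) : Prop :=
  forall A : R, 0 < A -> gGS alpha A u v.

End GS.

(* Main.v *)
Require Import Defs.
From HB Require Import structures.
From mathcomp Require Import all_boot all_order all_algebra.
From mathcomp Require Import all_classical all_reals all_analysis.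
From mathcomp Require Import ring lra zify.
Import Order.TTheory GRing.Theory Num.Theory.
Import numFieldNormedType.Exports.
Local Open Scope classical_set_scope.
Local Open Scope ring_scope.

(** Iterating Hardy's inequality n times in the last variable t gives
    [(1/2)(3/2)...(n - 1/2) ||f|| <= ||t^n d_t^n f||].  Taking p = k = n e_d
    in the definition of the space bounds the right-hand side by
    [C A^(2n) n^(alpha n) <= C A^(2n) n^n], whereas the constant on the left
    is at least [n! / 2^n >= n^n / 8^n].  Letting n tend to infinity with
    [8 A^2 < 1] forces f = 0.
    To avoid any measurability question about the iterated integrals, only
    lower bounds by constants on a box around a point are propagated through
    the outer variables. *)

(* [coord] is shadowed by the coordinate function of [vector]. *)
Local Notation coord := Defs.coord.

(** * Lower bounds for integrals over the half-line *)

(* The integral of a nonnegative function is a supremum over simple functions,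
   hence monotone even without the measurability required by
   [ge0_le_integral]. *)
Lemma ge0_le_integral_nonmeasurable d (T : measurableType d) (R : realType)
    (mu : {measure set T -> \bar R}) (D : set T) (f g : T -> \bar R) :
  (forall x, D x -> (0 <= f x <= g x)%E) ->
  (\int[mu]_(x in D) f x <= \int[mu]_(x in D) g x)%E.
Proof.
move=> fg; rewrite !ge0_integralE; last 2 first.
- by move=> x /fg /andP[f0 /(le_trans f0)].
- by move=> x /fg /andP[].
apply: le_ereal_sup => _ [h hf <-]; exists h => // x.
apply: le_trans (hf x) _; rewrite !patchE; case: ifPn => // /set_mem.
by move=> /fg /andP[].
Qed.

(** Comparison with [K] times the indicator of [[a, b]]; [F] will later be an inner iterated
    integral. *)
Lemma integral_ge_itv (R : realType) (a b K : R) (F : R -> \bar R) :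
  0 < a -> a <= b -> 0 <= K -> (forall t, (0 <= F t)%E) ->
  (forall t, a <= t <= b -> (K%:E <= F t)%E) ->
  (((b - a) * K)%:E <=
    \int[lebesgue_measure]_(t in [set t : R | (0 < t)%R]) F t)%E.
Proof.
move=> a0 ab K0 F0 FK.
have -> : ((b - a) * K)%:E =
    (\int[lebesgue_measure]_(t in `[a, b]%classic) K%:E)%E.
  rewrite integral_cst//= lebesgue_measure_itv/= lte_fin.
  case: ltP => [_|ba]; first by rewrite -EFinB -EFinM mulrC.
  by rewrite mule0 (@le_anti _ _ a b) ?ab ?ba// subrr mul0r.
have abS : `[a, b]%classic `<=` [set t : R | 0 < t].
  by move=> t /=; rewrite in_itv/= => /andP[/(lt_le_trans a0)].
rewrite -(setIidr abS) integral_mkcondr.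
apply: ge0_le_integral_nonmeasurable => t _; rewrite patchE.
case: ifPn => [/set_mem/=|_]; last by rewrite lexx F0.
by rewrite in_itv/= => tab; rewrite lee_fin K0 FK.
Qed.

(** * Comparison of powers and factorials *)

(** Each of the [n] factors of [(2n)(2n-1)...(n+1)] is at least [n], and this product is [n!] times
    the central binomial coefficient, one term of [(1+1)^(2n) = 4^n]. *)
Lemma expn_self_le_fact (n : nat) : (n ^ n <= 4 ^ n * n`!)%N.
Proof.
have le1 : (n ^ n <= (n + n) ^_ n)%N.
  rewrite ffact_prod.
  have -> : (n ^ n = \prod_(i < n) n)%N by rewrite prod_nat_const card_ord.
  by apply: leq_prod => i _; have := ltn_ord i; lia.
apply: leq_trans le1 _; rewrite -bin_ffact leq_mul2r orbC.
apply/orP; left.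
have -> : (4 ^ n = 2 ^ (n + n))%N by rewrite addnn -mul2n expnM.
have := expnDn 1 1 (n + n); rewrite /= => ->.
have ln : (n < (n + n).+1)%N by lia.
rewrite (bigD1 (Ordinal ln)) //= !exp1n !muln1; exact: leq_addr.
Qed.

(** * Iterated Hardy inequality in one variable *)

(* Hardy's inequality in pointwise form, with the integrations by parts recorded
   in the single boundary term Phi: one step uses
   [(t^(n+1) g_(n+1) + k t^n g_n)^2 >= 0] for [k = n + 1/2]. *)
Lemma hardy_potential (R : realType) (g : nat -> R -> R) (n : nat) :
  (forall i (t : R), 0 < t -> is_derive t 1 (g i) (g i.+1 t)) ->
  (forall i, exists C, forall t : R, 0 < t -> t ^+ i.+1 * `|g i t| <= C) ->
  exists Phi phi : R -> R,
  [/\ forall t : R, 0 < t -> is_derive t 1 Phi (phi t),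
      forall t : R, 0 < t -> {for t, continuous phi},
      exists K, forall t : R, 0 < t -> t * Phi t <= K,
      forall t : R, 0 < t -> 0 <= Phi t &
      forall t : R, 0 < t ->
        (\prod_(i < n) (i%:R + 2^-1) ^+ 2) * g 0%N t ^+ 2 <=
        t ^+ (2 * n) * g n t ^+ 2 + phi t].
Proof.
move=> dg bg; elim: n => [|n [Phi [phi [dPhi cphi [K PhiK] Phi0 le_phi]]]].
  exists (cst 0), (cst 0); split => //=.
  - by move=> t _; exact: is_derive_cst.
  - by move=> t _; exact: cst_continuous.
  - by exists 0 => t _; rewrite mulr0.
  - by move=> t t0; rewrite big_ord0 addr0 expr0.
pose k : R := n%:R + 2^-1.
(* [G'] is the derivative of [G], with [2 * k = 2n + 1]. Then [k * G'] contains the cross term of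
   the square, plus [2 k^2 t^(2n) g_n^2]. *)
pose G t := t ^+ (2 * n).+1 * g n t ^+ 2.
pose G' t := (2 * k) * t ^+ (2 * n) * g n t ^+ 2 +
  2 * t ^+ (2 * n).+1 * (g n t * g n.+1 t).
have cg i t : 0 < t -> {for t, continuous (g i)}.
  move=> t0; apply: differentiable_continuous; apply/derivable1_diffP.
  exact: (@ex_derive _ _ _ _ _ _ _ (dg i t t0)).
exists (fun t => k ^+ 2 * Phi t + k * G t), (fun t => k ^+ 2 * phi t + k * G' t).
split.
- move=> t t0; have ? := dg n t t0; have ? := dPhi t t0.
  have -> : (fun t => k ^+ 2 * Phi t + k * G t) =
      k ^+ 2 *: Phi + k *: (id ^+ (2 * n).+1 * g n ^+ 2).
    by apply/funext => s; rewrite /G !fctE.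
  apply: is_derive_eq; rewrite /GRing.scale /= !fctE /G' /k.
  rewrite expr1 -[(2 * n).+1]addn1 natrD natrM; by field.
- move=> t t0; rewrite /G'.
  have cX m : {for t, continuous (fun s : R => s ^+ m)} by exact: exprn_continuous.
  have cgn := cg n t t0; have cgn1 := cg n.+1 t t0.
  apply: cvgD; first by apply: cvgM; [exact: cvg_cst|exact: cphi].
  apply: cvgM; first exact: cvg_cst.
  apply: cvgD; apply: cvgM.
  + by apply: cvgM; [exact: cvg_cst|exact: cX].
  + by rewrite expr2; under eq_fun do rewrite expr2; exact: cvgM.
  + by apply: cvgM; [exact: cvg_cst|exact: cX].
  + exact: cvgM.
- have [C gC] := bg n.
  (* [t * G t] is the square of [t^(n+1) |g_n t|], which the decay assumption bounds by [C]. *)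
  exists (k ^+ 2 * K + k * C ^+ 2) => t t0.
  have -> : t * (k ^+ 2 * Phi t + k * G t) =
    k ^+ 2 * (t * Phi t) + k * (t ^+ n.+1 * `|g n t|) ^+ 2.
    rewrite exprMn real_normK ?num_real// /G -exprM muln2 mul2n doubleS !exprS; ring.
  have k0 : 0 <= k by rewrite /k addr_ge0// invr_ge0.
  apply: lerD; first by rewrite ler_wpM2l ?sqr_ge0// PhiK.
  rewrite ler_wpM2l// lerXn2r ?nnegrE ?gC//.
    by rewrite mulr_ge0// exprn_ge0// ltW.
  by apply: le_trans (gC t t0); rewrite mulr_ge0// exprn_ge0// ltW.
- move=> t t0; have k0 : 0 <= k by rewrite /k addr_ge0// invr_ge0.
  by rewrite addr_ge0// mulr_ge0 ?sqr_ge0 ?Phi0// /G mulr_ge0 ?sqr_ge0// exprn_ge0// ltW.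
- move=> t t0; rewrite big_ord_recr/= -/k -mulrA mulrCA.
  apply: le_trans (ler_wpM2l (sqr_ge0 k) (le_phi t t0)) _.
  rewrite -subr_ge0.
  (* After the induction hypothesis is used, the two sides differ by exactly this square. *)
  rewrite [leRHS](_ : _ = (t ^+ n.+1 * g n.+1 t + k * t ^+ n * g n t) ^+ 2) ?sqr_ge0//.
  rewrite /G' !mul2n doubleS -!addnn !exprS !exprD; ring.
Qed.

(** The pointwise inequality is integrated over [[a, N]]. The boundary contribution [Phi N - Phi a]
    is at most [K / N], which vanishes as [N] tends to infinity. *)
Lemma hardy_lower_bound (R : realType) (g : nat -> R -> R) (n : nat) (a b m : R) :
  (forall i (t : R), 0 < t -> is_derive t 1 (g i) (g i.+1 t)) ->
  (forall i, exists C, forall t : R, 0 < t -> t ^+ i.+1 * `|g i t| <= C) ->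
  0 < a -> a < b -> 0 <= m -> (forall t, a <= t <= b -> m <= g 0%N t ^+ 2) ->
  (((b - a) * (\prod_(i < n) (i%:R + 2^-1) ^+ 2 * m))%:E <=
    \int[lebesgue_measure]_(t in [set t : R | (0 < t)%R])
      (t ^+ (2 * n) * g n t ^+ 2)%:E)%E.
Proof.
move=> dg bg a0 ab m0 gm.
have [Phi [phi [dPhi cphi [K PhiK] Phi0 le_phi]]] := hardy_potential R g n dg bg.
set c := \prod_(i < n) _ in le_phi *.
have c0 : 0 <= c by apply: prodr_ge0 => i _; rewrite sqr_ge0.
pose q t := t ^+ (2 * n) * g n t ^+ 2.
have q0 t : 0 < t -> 0 <= q t.
  by move=> t0; rewrite mulr_ge0 ?sqr_ge0// exprn_ge0// ltW.
have cg t : 0 < t -> {for t, continuous (g n)}.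
  move=> t0; apply: differentiable_continuous; apply/derivable1_diffP.
  exact: (@ex_derive _ _ _ _ _ _ _ (dg n t t0)).
have cq t : 0 < t -> {for t, continuous q}.
  move=> t0; apply: cvgM; first exact: exprn_continuous.
  by rewrite expr2; under eq_fun do rewrite expr2; apply: cvgM; exact: cg.
have cPhi t : 0 < t -> {for t, continuous Phi}.
  move=> t0; apply: differentiable_continuous; apply/derivable1_diffP.
  exact: (@ex_derive _ _ _ _ _ _ _ (dPhi t t0)).
have pos N t : t \in `[a, N] -> 0 < t.
  by rewrite in_itv/= => /andP[/(lt_le_trans a0)].
have cwithin (f : R -> R) N : (forall t : R, 0 < t -> {for t, continuous f}) ->
    {within `[a, N], continuous f}.
  by move=> cf; apply: continuous_in_subspaceT => t /set_mem/= /pos; exact: cf.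
have intf (f : R -> R) N : (forall t : R, 0 < t -> {for t, continuous f}) ->
    lebesgue_measure.-integrable `[a, N] (EFin \o f).
  move=> cf; apply: continuous_compact_integrable; first exact: segment_compact.
  exact: cwithin.
have key N : b < N -> (((b - a) * (c * m))%:E <=
    \int[lebesgue_measure]_(t in [set t : R | (0 < t)%R]) (q t)%:E + (K / N)%:E)%E.
  move=> bN; have aN := lt_trans ab bN; have N0 := lt_trans a0 aN.
  have ftc : (\int[lebesgue_measure]_(x in `[a, N]) (phi x)%:E =
      (Phi N)%:E - (Phi a)%:E)%E.
    apply: continuous_FTC2 => //.
    - exact: cwithin.
    - split.
      + move=> x /subset_itv_oo_cc /pos x0; exact: (@ex_derive _ _ _ _ _ _ _ (dPhi x x0)).
      + exact/cvg_at_right_filter/cPhi.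
      + exact/cvg_at_left_filter/cPhi.
    - move=> x /subset_itv_oo_cc /pos x0.
      rewrite derive1E; exact: (@derive_val _ _ _ _ _ _ _ (dPhi x x0)).
  have le1 : (((b - a) * (c * m))%:E <=
      \int[lebesgue_measure]_(t in `[a, N]) (q t + phi t)%:E)%E.
    have -> : ((b - a) * (c * m))%:E =
        (\int[lebesgue_measure]_(t in `[a, b]%classic) (c * m)%:E)%E.
      by rewrite integral_cst//= lebesgue_measure_itv/= lte_fin ab -EFinB -EFinM mulrC.
    have abS : `[a, b]%classic `<=` `[a, N]%classic.
      by move=> t /=; rewrite !in_itv/= => /andP[-> /le_trans->//]; exact: ltW.
    rewrite -(setIidr abS) integral_mkcondr.
    apply: ge0_le_integral_nonmeasurable => t /pos t0; rewrite patchE.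
    have cg0 : c * g 0 t ^+ 2 <= q t + phi t by exact: le_phi.
    case: ifPn => [/set_mem/=|_].
      rewrite in_itv/= => /gm mg; rewrite !lee_fin mulr_ge0//=.
      by apply: le_trans cg0; rewrite ler_wpM2l.
    by rewrite lexx/= lee_fin (le_trans _ cg0)// mulr_ge0// sqr_ge0.
  apply: le_trans le1 _.
  under eq_integral do rewrite EFinD.
  rewrite integralD//; [|exact: intf|exact: intf].
  apply: leeD.
    have SN : `[a, N]%classic `<=` [set t : R | 0 < t] by move=> t /pos.
    rewrite -(setIidr SN) integral_mkcondr.
    apply: ge0_le_integral_nonmeasurable => t /= t0; rewrite patchE.
    by case: ifPn => _; rewrite !lee_fin q0//= lexx.
  (* [Phi a >= 0] is dropped, and [N * Phi N <= K] bounds the rest. *)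
  rewrite ftc -EFinB lee_fin; apply: (@le_trans _ _ (Phi N)).
    by rewrite gerBl Phi0.
  by rewrite ler_pdivlMr// mulrC PhiK.
change (((b - a) * (c * m))%:E <=
    \int[lebesgue_measure]_(t in [set t : R | (0 < t)%R]) (q t)%:E)%E.
set I := (\int[_]_(_ in _) _)%E in key *.
apply/lee_addgt0Pr => e e0.
have [N [bN KN]] : exists N, b < N /\ K / N <= e.
  (* This [N] exceeds both [b] and [|K| / e]. *)
  exists (b + `|K| / e + 1).
  have Ke : 0 <= `|K| / e by rewrite divr_ge0// ltW.
  have b0 := lt_trans a0 ab.
  have N0 : 0 < b + `|K| / e + 1 by lra.
  split; first lra.
  rewrite ler_pdivrMr//; apply: le_trans (ler_norm K) _.
  by rewrite mulrC -ler_pdivrMr//; lra.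
apply: le_trans (key N bN) _; rewrite leeD2l//.
Qed.

(** * Lines and iterated integrals over the orthant *)

Lemma setcoordE (R : realType) (d : nat) (x : 'rV[R]_d) (j i : 'I_d) (t : R) :
  coord (setcoord x j t) i = if i == j then t else coord x i.
Proof. by rewrite /coord /setcoord mxE. Qed.

(** Both difference quotients agree, since moving the [l]-th coordinate from [t] to [h + t] adds [h]
    times the unit vector. *)
Lemma is_derive_line (R : realType) (d : nat) (f : 'rV[R]_d -> R) (y : 'rV[R]_d)
    (l : 'I_d) (t : R) :
  derivable f (setcoord y l t) (unitv R l) ->
  is_derive t 1 (fun s => f (setcoord y l s)) (pderiv l f (setcoord y l t)).
Proof.
have E : (fun h : R => h^-1 *: (f (setcoord y l (h *: (1 : R) + t)) - f (setcoord y l t)))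
    = (fun h : R => h^-1 *: (f (h *: unitv R l + setcoord y l t) - f (setcoord y l t))).
  apply/funext => h; congr (_ *: (f _ - _)); apply/rowP => i.
  rewrite !mxE eqxx /=; case: (i == l) => /=; first by [].
  by rewrite mulr0 add0r.
move=> df; split; first by move: df; rewrite /derivable E.
by rewrite /pderiv /derive E.
Qed.

Lemma iint_ge0 (R : realType) (d : nat) (s : seq 'I_d) (h : 'rV[R]_d -> \bar R) :
  (forall x, 0 <= h x)%E -> forall x, (0 <= iint s h x)%E.
Proof.
by move=> h0; elim: s => [|j s IH] x //=; apply: integral_ge0 => t _.
Qed.

Lemma iint_rcons (R : realType) (d : nat) (s : seq 'I_d) (l : 'I_d)
    (h : 'rV[R]_d -> \bar R) (x : 'rV[R]_d) :
  iint (rcons s l) h x = iint s (iint [:: l] h) x.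
Proof.
by elim: s x => [//|j s IH] x /=; apply: eq_integral => t _; rewrite IH.
Qed.

(** [P] selects the coordinates confined to the box, leaving the Hardy variable free. Coordinates
    still in [s] carry no condition, because a later integration overwrites them. *)
Lemma iint_lower_bound (R : realType) (d : nat) (P : pred 'I_d) (x0 : 'rV[R]_d)
    (r K : R) (H : 'rV[R]_d -> \bar R) :
  orthant x0 -> 0 <= r -> 0 <= K -> (forall x, 0 <= H x)%E ->
  (forall x, (forall i, P i -> coord x0 i <= coord x i <= coord x0 i + r) ->
    (K%:E <= H x)%E) ->
  forall (s : seq 'I_d) (x : 'rV[R]_d),
  (forall i, P i -> i \notin s -> coord x0 i <= coord x i <= coord x0 i + r) ->
  ((r ^+ size s * K)%:E <= iint s H x)%E.
Proof.
move=> x0_gt0 r0 K0 H0 KH; elim=> [|j s IH] x xs /=.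
  by rewrite expr0 mul1r; apply: KH => i Pi; exact: xs.
(* One factor [r] becomes the length of the interval from [coord x0 j] to [coord x0 j + r]. *)
rewrite exprS -mulrA -[X in (X * _)%:E](addrK (coord x0 j)) [r + _]addrC.
apply: integral_ge_itv.
- exact: x0_gt0.
- by rewrite lerDl.
- by rewrite mulr_ge0// exprn_ge0.
- by move=> t; apply: iint_ge0.
- move=> t tj; apply: IH => i Pi nis; rewrite setcoordE.
  by case: eqP => [->//|/eqP ij]; apply: xs; rewrite // inE negb_or ij.
Qed.

(** Hardy's inequality is applied on each line in the last direction whose other coordinates lie in
    the box; the outer integrals then contribute [r^d]. *)
Lemma int_orthant_lower_bound (R : realType) (d : nat) (w : 'rV[R]_d.+1 -> R)
    (n : nat) (h : 'rV[R]_d.+1 -> R) (x0 : 'rV[R]_d.+1) (r m : R) :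
  smooth_orthant w ->
  (forall i, exists C, forall x, orthant x ->
    coord x ord_max ^+ i.+1 * `|pderivs (nseq i ord_max) w x| <= C) ->
  orthant x0 -> 0 < r -> 0 <= m ->
  (forall x, (forall j, coord x0 j <= coord x j <= coord x0 j + r) ->
    m <= w x ^+ 2) ->
  (forall x, 0 <= h x) ->
  (forall x, orthant x ->
    coord x ord_max ^+ (2 * n) * pderivs (nseq n ord_max) w x ^+ 2 <= h x) ->
  ((r ^+ d.+1 * (\prod_(i < n) (i%:R + 2^-1) ^+ 2 * m))%:E <=
    int_orthant (fun x => (h x)%:E))%E.
Proof.
move=> smw decw x0_gt0 r0 m0 wm h0 wh.
set c := \prod_(i < n) _.
have c0 : 0 <= c by apply: prodr_ge0 => i _; rewrite sqr_ge0.
set l : 'I_d.+1 := ord_max in decw wh *.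
(* The last variable is the innermost integration and is split off from the others. *)
rewrite /int_orthant enum_ordSr iint_rcons exprSr -mulrA.
set s := map _ _.
rewrite (_ : r ^+ d = r ^+ size s); last by rewrite size_map size_enum_ord.
apply: (iint_lower_bound R d.+1 (fun i => i != l) x0) => //.
- exact: ltW.
- by rewrite mulr_ge0 ?mulr_ge0// ltW.
- by move=> x; apply: iint_ge0 => y; rewrite lee_fin.
- move=> x xbox /=.
  have orth t : 0 < t -> orthant (setcoord x l t).
    move=> t0 i; rewrite setcoordE; case: eqP => // /eqP /xbox /andP[+ _].
    by apply: lt_le_trans; exact: x0_gt0.
  pose g i t := pderivs (nseq i l) w (setcoord x l t).
  apply: (@le_trans _ _ (\int[lebesgue_measure]_(t in [set t : R | (0 < t)%R])
      (t ^+ (2 * n) * g n t ^+ 2)%:E)%E).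
    rewrite -[X in (X * _)%:E](addrK (coord x0 l)) [r + _]addrC.
    apply: hardy_lower_bound.
    + by move=> i t t0; apply: is_derive_line; exact: (smw (nseq i l)).2 _ _ (orth t t0).
    + move=> i; have [C wC] := decw i; exists C => t t0.
      by have := wC _ (orth t t0); rewrite setcoordE eqxx.
    + exact: x0_gt0.
    + by rewrite ltrDl.
    + exact: m0.
    + move=> t tl; apply: wm => j; rewrite setcoordE.
      by case: eqP => [->//|/eqP /xbox].
  apply: ge0_le_integral_nonmeasurable => t /= t0.
  rewrite !lee_fin mulr_ge0 ?sqr_ge0 ?exprn_ge0 ?(ltW t0)//=.
  by have := wh _ (orth t t0); rewrite setcoordE eqxx.
(* The iteration starts at the point 0, so every coordinate other than [l] must occur in [s]. *)
- move=> i il; case: (unliftP l i) => [j ij|il']; last by rewrite il' eqxx in il.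
  suff is_s : i \in s by rewrite is_s.
  rewrite ij.
  apply/mapP; exists j; first by rewrite mem_enum.
  by apply/val_inj; rewrite /= /bump leqNgt ltn_ord.
Qed.

(** * The Hardy constant and multi-indices in one direction *)

(** Factor by factor, [2 * (i + 1/2) = 2i + 1 >= i + 1]. *)
Lemma prod_half_lower_bound (R : realType) (n : nat) :
  (n`!)%:R ^+ 2 <= 4 ^+ n * \prod_(i < n) (i%:R + 2^-1) ^+ 2 :> R.
Proof.
elim: n => [|n IH]; first by rewrite big_ord0 expr0 mulr1 fact0 expr1n.
rewrite big_ord_recr/= factS natrM exprMn [4 ^+ _]exprS.
rewrite [leRHS](_ : _ = (2 * (n%:R + 2^-1)) ^+ 2 *
  (4 ^+ n * \prod_(i < n) (i%:R + 2^-1) ^+ 2)); last by ring.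
apply: ler_pM; rewrite ?sqr_ge0//.
have n0 : 0 <= n%:R :> R by [].
rewrite lerXn2r ?nnegrE ?ler0n//; rewrite -[n.+1%:R]natr1; lra.
Qed.

(** The multi-index [n e_l]. *)
Definition monoidx (d : nat) (l : 'I_d) (n : nat) : 'I_d -> nat :=
  fun j => if j == l then n else 0%N.

Lemma mdirs_monoidx (d : nat) (l : 'I_d) (n : nat) :
  mdirs (monoidx d l n) = nseq n l.
Proof.
rewrite /mdirs.
have : l \in enum 'I_d by rewrite mem_enum.
have : uniq (enum 'I_d) by exact: enum_uniq.
have N s : l \notin s -> flatten [seq nseq (monoidx d l n j) j | j <- s] = [::].
  elim: s => [//|j s IH]; rewrite inE negb_or => /andP[jl ls] /=.
  by rewrite /monoidx eq_sym (negPf jl)/= IH.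
elim: (enum 'I_d) => [//|j s IH] /= /andP[js us].
rewrite inE => /predU1P[lj|ls].
  by rewrite -lj N ?cats0 /monoidx ?eqxx// lj.
rewrite IH// /monoidx; case: eqP => [jl|//].
by rewrite jl ls in js.
Qed.

Lemma mabs_monoidx (d : nat) (l : 'I_d) (n : nat) : mabs (monoidx d l n) = n.
Proof. by rewrite /mabs /monoidx -big_mkcond big_pred1_eq. Qed.

Lemma xpow_monoidx (R : realType) (d : nat) (x : 'rV[R]_d) (l : 'I_d) (n : nat) :
  xpow x (monoidx d l n) = coord x l ^+ n.
Proof.
rewrite /xpow (bigD1 l)//= {1}/monoidx eqxx big1 ?mulr1// => j jl.
by rewrite /monoidx (negPf jl) expr0.
Qed.

Lemma xhalf_monoidx (R : realType) (d : nat) (x : 'rV[R]_d) (l : 'I_d) (n : nat) :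
  orthant x -> xhalf x (monoidx d l n) (monoidx d l n) = coord x l ^+ n.
Proof.
move=> x0; rewrite /xhalf (bigD1 l)//= {1 2}/monoidx eqxx big1 ?mulr1 => [|j jl].
  by rewrite -(powR_mulrn _ (ltW (x0 l))); congr powR; rewrite natrD; field.
by rewrite /monoidx (negPf jl) mul0r powRr0.
Qed.

Lemma kpow_monoidx (R : realType) (d : nat) (alpha : R) (l : 'I_d) (n : nat) :
  kpow alpha (monoidx d l n) = powR n%:R (alpha / 2 * n%:R).
Proof.
rewrite /kpow (bigD1 l)//= {1 2}/monoidx eqxx big1 ?mulr1// => j jl.
by rewrite /monoidx (negPf jl) mulr0 powRr0.
Qed.

(** The square is [n^(alpha n)], and [alpha <= 1] enters here. Monotonicity in the exponent needs
    base at least 1, so [n = 0] is treated apart, with both sides 1. *)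
Lemma sqr_kpow_monoidx_le (R : realType) (d : nat) (alpha : R) (l : 'I_d) (n : nat) :
  0 < alpha -> alpha <= 1 -> kpow alpha (monoidx d l n) ^+ 2 <= n%:R ^+ n.
Proof.
move=> a0 a1; rewrite kpow_monoidx -powR_mulrn ?powR_ge0// -powRrM.
rewrite (_ : _ * 2%:R = alpha * n%:R); last by field.
case: n => [|n]; first by rewrite mulr0 powRr0 expr0.
rewrite -powR_mulrn//; apply: ler_powR; first by rewrite ler1n.
by rewrite ler_piMl.
Qed.

Lemma wL2norm_monoidx_le (R : realType) (d : nat) (u v : 'rV[R]_d -> R)
    (p : 'I_d -> nat) (B : R) :
  (wL2norm u v p p <= B%:E)%E ->
  (int_orthant (fun x =>
     ((xhalf x p p ^+ 2) * (dmulti p u x ^+ 2 + dmulti p v x ^+ 2))%:E)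
   <= (B ^+ 2)%:E)%E.
Proof.
rewrite /wL2norm => HB.
set I := int_orthant _ in HB *.
have I0 : (0 <= I)%E.
  by apply: iint_ge0 => x; rewrite lee_fin mulr_ge0 ?addr_ge0 ?sqr_ge0.
have B0 : 0 <= B by rewrite -lee_fin (le_trans _ HB)// sqrte_ge0.
rewrite -lee_sqrt ?lee_fin ?sqr_ge0// EFin_expe sqrte_sqr.
by rewrite gee0_abs ?lee_fin.
Qed.

(** * Vanishing of the functions *)

Lemma geometric_decay_eq0 (R : realType) (m C : R) :
  0 <= m -> (forall n, m * 4 ^+ n <= C) -> m = 0.
Proof.
move=> m0 mC; apply/eqP; rewrite -[_ == _]negbK; apply/negP => mN0.
have mgt0 : 0 < m by rewrite lt_neqAle eq_sym mN0.
have C0 : 0 <= C by apply: le_trans (mC 0%N); rewrite mulr_ge0.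
(* For positive [m], some [n] satisfies [C / m < n < 4^n], contradicting the bound. *)
have := archi_boundP (divr_ge0 C0 m0); set n := Num.bound _ => Cn.
have := mC n; rewrite mulrC -ler_pdivlMr// leNgt => /negP; apply.
apply: (lt_trans Cn); rewrite -natrX ltr_nat; exact: ltn_expl.
Qed.

Lemma continuous_box_lower_bound (R : realType) (d : nat) (w : 'rV[R]_d -> R)
    (x : 'rV[R]_d) :
  {for x, continuous w} -> exists2 r, 0 < r &
  forall y, (forall j, coord x j <= coord y j <= coord x j + r) ->
    (w x / 2) ^+ 2 <= w y ^+ 2.
Proof.
move=> cw; have [w0|wN0] := eqVneq (w x) 0.
  by exists 1 => // y _; rewrite w0 mul0r expr0n/= sqr_ge0.
have wgt0 : 0 < `|w x| / 2 by rewrite divr_gt0 ?normr_gt0.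
have /cvgrPdist_lt /(_ _ wgt0) := cw.
(* Halving [e] puts the closed box inside the open sup-norm ball, where [w] stays within [|w x| / 2]
   of [w x]. *)
rewrite -filter_from_ballE => -[e/= e0 we]; exists (e / 2); first by rewrite divr_gt0.
move=> y xy.
have /we : ball x e y.
  split=> // i j; rewrite ord1; have := xy j; rewrite /Defs.coord /ball/= => /andP[xy1 xy2].
  by rewrite distrC ger0_norm; lra.
move=> wxy.
have wy : `|w x / 2| <= `|w y|.
  rewrite normrM (ger0_norm (_ : 0 <= 2^-1)) ?invr_ge0//.
  have := ler_dist_dist (w x) (w y); have := ler_norm (`|w x| - `|w y|).
  lra.
by rewrite -(real_normK (num_real (w x / 2))) -(real_normK (num_real (w y))) lerXn2r.
Qed.

(** [w] stands for the real or the imaginary part; the domination hypothesis transfers to it the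
    bounds on the complex-valued function. *)
Lemma gGS_all_vanish (R : realType) (d : nat) (alpha : R)
    (u v w : 'rV[R]_d.+1 -> R) :
  0 < alpha -> alpha <= 1 -> gGS_all alpha u v -> smooth_orthant w ->
  (forall n x, pderivs (nseq n ord_max) w x ^+ 2 <=
    pderivs (nseq n ord_max) u x ^+ 2 + pderivs (nseq n ord_max) v x ^+ 2) ->
  forall x, orthant x -> w x = 0.
Proof.
move=> alpha0 alpha1 GS smw wuv x x_gt0.
(* With [A = 1/4] one has [8 A^2 = 1/2], and the squared estimates gain a factor [4^(-n)]. *)
have A0 : 0 < 4^-1 :> R by [].
have [[_ [_ [_ decay]]] [C normC]] := GS _ A0.
have cw : {for x, continuous w} := (smw [::]).1 x x_gt0.
have [r r0 wbox] := continuous_box_lower_bound R d.+1 w x cw.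
have decw i : exists C, forall y, orthant y ->
    coord y ord_max ^+ i.+1 * `|pderivs (nseq i ord_max) w y| <= C.
  (* The weight has order [i + 1], one more than the derivative, as the boundary terms in Hardy's
     inequality require. *)
  have [D uvD] := decay (monoidx d.+1 ord_max i.+1) (monoidx d.+1 ord_max i).
  exists D => y y_gt0; apply: le_trans (uvD y y_gt0).
  rewrite xpow_monoidx /dmulti mdirs_monoidx ler_wpM2l ?exprn_ge0 ?(ltW (y_gt0 _))//.
  by rewrite -sqrtr_sqr ler_wsqrtr.
have bound n : r ^+ d.+1 * (w x / 2) ^+ 2 * 4 ^+ n <= C ^+ 2.
  pose p := monoidx d.+1 ord_max n.
  have := wL2norm_monoidx_le R d.+1 u v p _ (normC p p).
  rewrite mabs_monoidx; set B := C * _ => intB.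
  pose h y := xhalf y p p ^+ 2 * (dmulti p u y ^+ 2 + dmulti p v y ^+ 2).
  have h0 y : 0 <= h y by rewrite mulr_ge0 ?addr_ge0 ?sqr_ge0.
  have wh y : orthant y ->
      coord y ord_max ^+ (2 * n) * pderivs (nseq n ord_max) w y ^+ 2 <= h y.
    move=> y_gt0; rewrite /h xhalf_monoidx// /dmulti mdirs_monoidx mulnC exprM.
    by rewrite ler_wpM2l// sqr_ge0.
  have := int_orthant_lower_bound R d w n h x r _ smw decw x_gt0 r0 (sqr_ge0 _) wbox h0 wh.
  move=> /le_trans /(_ intB); rewrite lee_fin.
  set c := \prod_(i < n) _; set m := (w x / 2) ^+ 2 => lowB.
  have upB : B ^+ 2 <= C ^+ 2 * (4^-1 ^+ (n + n)) ^+ 2 * (n%:R ^+ n) ^+ 2.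
    have k2 := sqr_kpow_monoidx_le R d.+1 alpha ord_max n alpha0 alpha1.
    rewrite -/p in k2; rewrite /B -mulrA -expr2 exprMn [X in _ * X]exprMn mulrA.
    rewrite ler_wpM2l ?(mulr_ge0 (sqr_ge0 _) (sqr_ge0 _))//.
    by rewrite lerXn2r// nnegrE ?sqr_ge0 ?exprn_ge0.
  have nn : (n%:R ^+ n) ^+ 2 <= (4 ^+ n) ^+ 2 * (4 ^+ n * c) :> R.
    apply: (@le_trans _ _ ((4 ^+ n * (n`!)%:R) ^+ 2)).
      rewrite lerXn2r ?nnegrE ?mulr_ge0 ?exprn_ge0 ?ler0n//.
      have := expn_self_le_fact n; rewrite -(ler_nat R) natrM !natrX; exact.
    by rewrite exprMn ler_wpM2l ?sqr_ge0// prod_half_lower_bound.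
  have c0 : 0 < c by apply: prodr_gt0 => i _; rewrite exprn_gt0// ltr_wpDl.
  have pos4 : 0 < 4 ^+ n :> R by rewrite exprn_gt0.
  (* After multiplication by the Hardy constant [c], the powers of 4 balance:
     [4^n * 4^(-4n) * 4^(2n) * 4^n = 1]. *)
  rewrite -(ler_pM2r c0).
  rewrite [leLHS](_ : _ = 4 ^+ n * (r ^+ d.+1 * (c * m))); last by ring.
  apply: le_trans (ler_wpM2l (ltW pos4) (le_trans lowB upB)) _.
  rewrite [leLHS](_ : _ = C ^+ 2 * (4 ^+ n * (4^-1 ^+ (n + n)) ^+ 2 *
    (n%:R ^+ n) ^+ 2)); last by ring.
  rewrite ler_wpM2l ?sqr_ge0//.
  apply: (le_trans (ler_wpM2l (mulr_ge0 (ltW pos4) (sqr_ge0 _)) nn)).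
  rewrite exprD exprVn [leLHS](_ : _ = c) //.
  by field; rewrite gt_eqF.
have m0 : r ^+ d.+1 * (w x / 2) ^+ 2 = 0.
  apply: geometric_decay_eq0 bound.
  by rewrite mulr_ge0 ?sqr_ge0 ?exprn_ge0 ?ltW.
apply/eqP; move/eqP: m0.
rewrite mulf_eq0 expf_eq0 (gt_eqF r0) andbF/= sqrf_eq0 mulf_eq0 invr_eq0.
by rewrite (gt_eqF (_ : 0 < 2)) ?orbF.
Qed.

Theorem theorem2p8 (R : realType) (d : nat) (alpha : R) :
  (0 < d)%N -> 0 < alpha -> alpha <= 1 ->
  forall u v : 'rV[R]_d -> R, gGS_all alpha u v ->
  forall x : 'rV[R]_d, orthant x -> u x = 0 /\ v x = 0.
Proof.
(* Positive dimension provides a last coordinate. *)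
case: d => [//|d] _ alpha0 alpha1 u v GS x x_gt0.
have [[smu [smv _]] _] := GS 1 ltr01.
split; apply: (gGS_all_vanish R d alpha u v) => // n y.
  by rewrite lerDl sqr_ge0.
by rewrite lerDr sqr_ge0.
Qed.
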